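(* Let $((B,\beta),(H,\alpha))$ be a matched monoidal Hom-Hopf algebra pair, where $(B,\beta)$ and $(H,\alpha)$ are finite-dimensional monoidal Hom-Hopf algebras over a field $k$ with antipodes $S_B,S_H$, with actions $\triangleleft:H\otimes B\to H$ and $\triangleright:H\otimes B\to B$. Then the vector space $B\otimes H$ (write $a\ltimes h$ for $a\otimes h$), with twisting automorphism $\beta\otimes\alpha$, the product $$(a\ltimes h)(b\ltimes g)=\sum a(h_{1}\triangleright b_{1})\ltimes(h_{2}\triangleleft b_{2})g,$$ unit $1_B\ltimes 1_H$, and the usual tensor coproduct $\Delta(a\ltimes h)=\sum (a_1\ltimes h_1)\otimes(a_2\ltimes h_2)$ with counit $\varepsilon_B\otimes\varepsilon_H$, is a monoidal Hom-Hopf algebra $(B\bowtie H,\beta\otimes\alpha)$ (the double cross product), with antipode $$S(a\ltimes h)=\sum S_{H}(h_{2})\triangleright S_{B}(a_{2})\ltimes S_{H}(h_{1})\triangleleft S_{B}(a_{1}).$$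
   Context: All vector spaces, tensor products and linear maps are over a fixed field $k$; Sweedler notation $\Delta(c)=\sum c_1\otimes c_2$ is used. Monoidal Hom-algebra $(A,\alpha)$: a vector space $A$ with a linear automorphism $\alpha$, a linear multiplication $a\otimes b\mapsto ab$ and an element $1_A$ with $\alpha(a)(bc)=(ab)\alpha(c)$, $a1_A=\alpha(a)=1_Aa$, $\alpha(ab)=\alpha(a)\alpha(b)$, $\alpha(1_A)=1_A$. Monoidal Hom-coalgebra $(C,\gamma)$: a vector space $C$ with a linear automorphism $\gamma$ and linear maps $\Delta:C\to C\otimes C$, $\varepsilon:C\to k$ with $\sum\gamma^{-1}(c_1)\otimes\Delta(c_2)=\sum\Delta(c_1)\otimes\gamma^{-1}(c_2)$, $\sum c_1\varepsilon(c_2)=\sum\varepsilon(c_1)c_2=\gamma^{-1}(c)$, $\Delta(\gamma(c))=\sum\gamma(c_1)\otimes\gamma(c_2)$, $\varepsilon(\gamma(c))=\varepsilon(c)$. Monoidal Hom-bialgebra: $(H,\alpha)$ which is both a monoidal Hom-algebra and a monoidal Hom-coalgebra (same $\alpha$), with $\Delta$ and $\varepsilon$ multiplicative and unital (componentwise product on $H\otimes H$). Monoidal Hom-Hopf algebra: a monoidal Hom-bialgebra with a linear map $S:H\to H$ (antipode) such that $S\alpha=\alpha S$ and $\sum S(h_1)h_2=\varepsilon(h)1=\sum h_1S(h_2)$. Left $(H,\alpha)$-Hom-module $(M,\mu)$: $\mu$ a linear automorphism of $M$ and a linear map $\triangleright:H\otimes M\to M$ with $\alpha(h)\triangleright(g\triangleright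 m)=(hg)\triangleright\mu(m)$, $1\triangleright m=\mu(m)$, $\mu(h\triangleright m)=\alpha(h)\triangleright\mu(m)$. Right Hom-modules are defined symmetrically: $(m\triangleleft a)\triangleleft\beta(b)=\mu(m)\triangleleft(ab)$, $m\triangleleft1=\mu(m)$, $\mu(m\triangleleft a)=\mu(m)\triangleleft\beta(a)$. A left $(H,\alpha)$-Hom-module coalgebra is a monoidal Hom-coalgebra $(B,\beta)$ that is a left Hom-module (with automorphism $\beta$) with $\Delta(h\triangleright a)=\sum(h_1\triangleright a_1)\otimes(h_2\triangleright a_2)$ and $\varepsilon(h\triangleright a)=\varepsilon(h)\varepsilon(a)$; right Hom-module coalgebras are defined symmetrically. Matched monoidal Hom-Hopf algebra pair $((B,\beta),(H,\alpha))$: monoidal Hom-Hopf algebras $(B,\beta)$, $(H,\alpha)$ such that $H$ is a right $B$-Hom-module coalgebra via $\triangleleft:H\otimes B\to H$ and $B$ is a left $H$-Hom-module coalgebra via $\triangleright:H\otimes B\to B$, and for all $h,g\in H$, $a,b\in B$: (1) $(hg)\triangleleft a=\sum(h\triangleleft(g_{1}\triangleright\beta^{-1}(a_{1})))(\alpha(g_{2})\triangleleft a_{2})$ and $1_{H}\triangleleft a=\varepsilon_{B}(a)1_{H}$; (2) $h\triangleright(ab)=\sum(h_{1}\triangleright\beta(a_{1}))((\alpha^{-1}(h_{2})\triangleleft a_{2})\triangleright b)$ and $h\triangleright 1_{B}=\varepsilon_{H}(h)1_{B}$; (3) $\sum(h_{1}\triangleleft a_{1})\otimes(h_{2}\triangleright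 a_{2})=\sum(h_{2}\triangleleft a_{2})\otimes(h_{1}\triangleright a_{1})$.
   Formalization: In condition (1) of the definition of a matched pair, the printed left side $(hg)\triangleright a$ lies in $B$ while the right side lies in $H$; it is read as $(hg)\triangleleft a$. *)

(* Defs.v *)
From HB Require Import structures.
From mathcomp Require Import all_boot all_order all_algebra.

Set Implicit Arguments.
Unset Strict Implicit.
Unset Printing Implicit Defensive.

Import GRing.Theory.
Local Open Scope ring_scope.

(* The tensor product of two finite-dimensional spaces is modelled by the     *)
(* matrices of coordinates in the library bases of U and V; its universal     *)
(* property is given by tensorp_bilinear, tlift_pure and tlift_unique.        *)
Definition tensor (k : fieldType) (U V : vectType k) : vectType k :=
  'M[k]_(\dim {:U}, \dim {:V}).

Definition tensorp (k : fieldType) (U V : vectType k) (u : U) (v : V) :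
    tensor U V :=
  \matrix_(i, j) (coord (vbasis {:U}) i u * coord (vbasis {:V}) j v).

Notation "u *t v" := (tensorp u v) (at level 40, left associativity).

Definition tlift_fun (k : fieldType) (U V W : vectType k) (f : U -> V -> W)
    (t : tensor U V) : W :=
  \sum_i \sum_j (t : 'M[k]_(_, _)) i j *: f (vbasis {:U})`_i (vbasis {:V})`_j.

Lemma tlift_is_linear (k : fieldType) (U V W : vectType k) (f : U -> V -> W) :
  linear (tlift_fun f).
Proof.
move=> a s t; rewrite /tlift_fun scaler_sumr -big_split /=.
apply: eq_bigr => i _; rewrite scaler_sumr -big_split /=.
by apply: eq_bigr => j _; rewrite !mxE scalerDl scalerA.
Qed.

HB.instance Definition _ (k : fieldType) (U V W : vectType k)
  (f : U -> V -> W) :=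
  GRing.isLinear.Build k (tensor U V) W *:%R (tlift_fun f) (tlift_is_linear f).

(* The linear map on U (x) V induced by a bilinear f. It is a total operation *)
(* on arbitrary f, but is only meaningful (independent of the bases) when f   *)
(* is bilinear, as is the case in all the uses below.                         *)
Definition tlift (k : fieldType) (U V W : vectType k) (f : U -> V -> W) :
    'Hom(tensor U V, W) := linfun (tlift_fun f).

(* Sweedler notation: for t = \sum t_1 (x) t_2 and F bilinear in (x, y), this *)
(* is \sum F(t_1, t_2); typically t = Delta(c).                               *)
Notation "\sweedler_ ( x , y <- t ) F" := (tlift (fun x y => F) t)
  (at level 41, x name, y name, t at level 200, F at level 41,
   format "'[' \sweedler_ ( x ,  y  <-  t ) '/  '  F ']'").

Lemma tensorp_bilinear (k : fieldType) (U V : vectType k) :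
  bilinear_for *:%R *:%R (@tensorp k U V).
Proof.
split=> [v a u1 u2|u a v1 v2]; apply/matrixP=> i j; rewrite !mxE linearP.
  by rewrite mulrDl mulrA.
by rewrite mulrDr mulrCA.
Qed.

Lemma tlift_pure (k : fieldType) (U V W : vectType k) (f : U -> V -> W) :
  bilinear_for *:%R *:%R f -> forall u v, tlift f (u *t v) = f u v.
Proof.
case=> fl fr u v; rewrite lfunE /= /tlift_fun.
pose gl v0 : {linear U -> W} :=
  HB.pack (f^~ v0) (GRing.isLinear.Build _ _ _ _ (f^~ v0) (fl v0)).
pose gr u0 : {linear V -> W} :=
  HB.pack (f u0) (GRing.isLinear.Build _ _ _ _ (f u0) (fr u0)).
have glZ c u0 v0 : f (c *: u0) v0 = c *: f u0 v0 := linearZ_LR (gl v0) c u0.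
have grZ c u0 v0 : f u0 (c *: v0) = c *: f u0 v0 := linearZ_LR (gr u0) c v0.
rewrite -[f u v]/(gl v u) {2}(coord_vbasis (memvf u)) linear_sum.
apply: eq_bigr => i _; rewrite /= glZ.
rewrite -[f _ v]/(gr _ v) {2}(coord_vbasis (memvf v)) linear_sum scaler_sumr.
by apply: eq_bigr => j _; rewrite /= mxE grZ scalerA.
Qed.

Lemma tensor_sum_pure (k : fieldType) (U V : vectType k) (t : tensor U V) :
  t = \sum_i \sum_j (t : 'M[k]_(_, _)) i j *:
        ((vbasis {:U})`_i *t (vbasis {:V})`_j).
Proof.
have fU := basis_free (vbasisP {:U}); have fV := basis_free (vbasisP {:V}).
apply/matrixP=> i j.
rewrite summxE (bigD1 i) //= summxE (bigD1 j) //= !mxE !coord_free // !eqxx.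
rewrite !mulr1 !big1 ?addr0 // => [i' ne_i'i|j' ne_j'j].
  rewrite summxE big1 // => j' _.
  by rewrite !mxE !coord_free // (negPf ne_i'i) mul0r mulr0.
by rewrite !mxE !coord_free // (negPf ne_j'j) !mulr0.
Qed.

Lemma tlift_unique (k : fieldType) (U V W : vectType k)
    (f g : 'Hom(tensor U V, W)) :
  (forall u v, f (u *t v) = g (u *t v)) -> f = g.
Proof.
move=> fg; apply/lfunP=> t; rewrite (tensor_sum_pure t) !linear_sum.
apply: eq_bigr => i _; rewrite !linear_sum.
by apply: eq_bigr => j _; rewrite !linearZ /= fg.
Qed.

Lemma tlift_comb (k : fieldType) (U V W : vectType k) (c : k)
    (f g h : U -> V -> W) :
  (forall u v, f u v = c *: g u v + h u v) ->
  forall t, tlift f t = c *: tlift g t + tlift h t.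
Proof.
move=> fE t; rewrite !lfunE /= /tlift_fun scaler_sumr -big_split /=.
apply: eq_bigr => i _; rewrite scaler_sumr -big_split /=.
by apply: eq_bigr => j _; rewrite fE scalerDr !scalerA mulrC.
Qed.

Section HomStructures.

Variable k : fieldType.

Section Algebra.

Variables (A : vectType k) (alpha : 'End(A)) (mul : 'Hom(tensor A A, A)).
Variable one : A.
Local Notation "a ** b" := (mul (a *t b)) (at level 39, left associativity).

Record is_hom_algebra : Prop := IsHomAlgebra {
  ha_bij : bijective alpha;
  ha_assoc : forall a b c, alpha a ** (b ** c) = (a ** b) ** alpha c;
  ha_mul1 : forall a, a ** one = alpha a;
  ha_1mul : forall a, one ** a = alpha a;
  ha_twistM : forall a b, alpha (a ** b) = alpha a ** alpha b;
  ha_twist1 : alpha one = one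
}.

End Algebra.

Section Coalgebra.

Variables (C : vectType k) (gamma : 'End(C)) (Delta : 'Hom(C, tensor C C)).
Variable eps : 'Hom(C, k^o).
(* This is the two-sided inverse of gamma, since gamma is bijective. *)
Local Notation gammaV := (gamma^-1)%VF.

(* Both sides of hc_coassoc are written in C (x) (C (x) C). *)
Record is_hom_coalgebra : Prop := IsHomCoalgebra {
  hc_bij : bijective gamma;
  hc_coassoc : forall c,
    \sweedler_(c1, c2 <- Delta c)
      \sweedler_(c21, c22 <- Delta c2) (gammaV c1 *t (c21 *t c22)) =
    \sweedler_(c1, c2 <- Delta c)
      \sweedler_(c11, c12 <- Delta c1) (c11 *t (c12 *t gammaV c2));
  hc_counitr : forall c,
    \sweedler_(c1, c2 <- Delta c) (eps c2 *: c1) = gammaV c;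
  hc_counitl : forall c,
    \sweedler_(c1, c2 <- Delta c) (eps c1 *: c2) = gammaV c;
  hc_comul_twist : forall c,
    Delta (gamma c) = \sweedler_(c1, c2 <- Delta c) (gamma c1 *t gamma c2);
  hc_counit_twist : forall c, eps (gamma c) = eps c
}.

End Coalgebra.

Section Bialgebra.

Variables (H : vectType k) (alpha : 'End(H)) (mul : 'Hom(tensor H H, H)).
Variables (one : H) (Delta : 'Hom(H, tensor H H)) (eps : 'Hom(H, k^o)).
Local Notation "a ** b" := (mul (a *t b)) (at level 39, left associativity).

Record is_hom_bialgebra : Prop := IsHomBialgebra {
  hb_alg : is_hom_algebra alpha mul one;
  hb_coalg : is_hom_coalgebra alpha Delta eps;
  hb_comulM : forall h g,
    Delta (h ** g) =
    \sweedler_(h1, h2 <- Delta h)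
      \sweedler_(g1, g2 <- Delta g) ((h1 ** g1) *t (h2 ** g2));
  hb_comul1 : Delta one = one *t one;
  hb_counitM : forall h g, eps (h ** g) = eps h * eps g;
  hb_counit1 : eps one = 1
}.

Record is_antipode (S : 'End(H)) : Prop := IsAntipode {
  anti_twist : forall h, S (alpha h) = alpha (S h);
  anti_mull : forall h,
    \sweedler_(h1, h2 <- Delta h) (S h1 ** h2) = eps h *: one;
  anti_mulr : forall h,
    \sweedler_(h1, h2 <- Delta h) (h1 ** S h2) = eps h *: one
}.

End Bialgebra.

Record homHopfData (H : vectType k) := HomHopfData {
  htwist : 'End(H);
  hmul : 'Hom(tensor H H, H);
  hone : H;
  hcomul : 'Hom(H, tensor H H);
  hcounit : 'Hom(H, k^o);
  hantipode : 'End(H)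
}.

Record is_hom_hopf_algebra (H : vectType k) (D : homHopfData H) : Prop :=
  IsHomHopfAlgebra {
    hh_bialg : is_hom_bialgebra (htwist D) (hmul D) (hone D)
                                (hcomul D) (hcounit D);
    hh_antipode : is_antipode (htwist D) (hmul D) (hone D)
                              (hcomul D) (hcounit D) (hantipode D)
  }.

Section LeftModule.

Variables (H : vectType k) (D : homHopfData H).

Record is_left_hom_module (M : vectType k) (mu : 'End(M))
    (act : 'Hom(tensor H M, M)) : Prop := IsLeftHomModule {
  lm_bij : bijective mu;
  lm_assoc : forall h g m,
    act (htwist D h *t act (g *t m)) = act (hmul D (h *t g) *t mu m);
  lm_1act : forall m, act (hone D *t m) = mu m;
  lm_twist : forall h m, mu (act (h *t m)) = act (htwist D h *t mu m)
}.

Record is_left_hom_module_coalgebra (B : vectType k) (beta : 'End(B))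
    (Delta : 'Hom(B, tensor B B)) (eps : 'Hom(B, k^o))
    (act : 'Hom(tensor H B, B)) : Prop := IsLeftHomModuleCoalgebra {
  lmc_coalg : is_hom_coalgebra beta Delta eps;
  lmc_mod : is_left_hom_module beta act;
  lmc_comul : forall h a,
    Delta (act (h *t a)) =
    \sweedler_(h1, h2 <- hcomul D h)
      \sweedler_(a1, a2 <- Delta a) (act (h1 *t a1) *t act (h2 *t a2));
  lmc_counit : forall h a, eps (act (h *t a)) = hcounit D h * eps a
}.

End LeftModule.

Section RightModule.

Variables (B : vectType k) (D : homHopfData B).

Record is_right_hom_module (M : vectType k) (mu : 'End(M))
    (act : 'Hom(tensor M B, M)) : Prop := IsRightHomModule {
  rm_bij : bijective mu;
  rm_assoc : forall m a b,
    act (act (m *t a) *t htwist D b) = act (mu m *t hmul D (a *t b));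
  rm_act1 : forall m, act (m *t hone D) = mu m;
  rm_twist : forall m a, mu (act (m *t a)) = act (mu m *t htwist D a)
}.

Record is_right_hom_module_coalgebra (H : vectType k) (alpha : 'End(H))
    (Delta : 'Hom(H, tensor H H)) (eps : 'Hom(H, k^o))
    (act : 'Hom(tensor H B, H)) : Prop := IsRightHomModuleCoalgebra {
  rmc_coalg : is_hom_coalgebra alpha Delta eps;
  rmc_mod : is_right_hom_module alpha act;
  rmc_comul : forall h a,
    Delta (act (h *t a)) =
    \sweedler_(h1, h2 <- Delta h)
      \sweedler_(a1, a2 <- hcomul D a) (act (h1 *t a1) *t act (h2 *t a2));
  rmc_counit : forall h a, eps (act (h *t a)) = eps h * hcounit D a
}.

End RightModule.

Section MatchedPair.

Variables (B H : vectType k) (DB : homHopfData B) (DH : homHopfData H).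
Variables (ract : 'Hom(tensor H B, H)) (lact : 'Hom(tensor H B, B)).

Local Notation alpha := (htwist DH).
Local Notation beta := (htwist DB).
Local Notation alphaV := ((htwist DH)^-1)%VF.
Local Notation betaV := ((htwist DB)^-1)%VF.
Local Notation "h <<| a" := (ract (h *t a)) (at level 38, no associativity).
Local Notation "h |>> a" := (lact (h *t a)) (at level 38, no associativity).
Local Notation "h *H g" := (hmul DH (h *t g)) (at level 39).
Local Notation "a *B b" := (hmul DB (a *t b)) (at level 39).
Local Notation S_H := (hantipode DH).
Local Notation S_B := (hantipode DB).

Record is_matched_pair : Prop := IsMatchedPair {
  mp_hopfB : is_hom_hopf_algebra DB;
  mp_hopfH : is_hom_hopf_algebra DH;
  mp_ract : is_right_hom_module_coalgebra DB alpha (hcomul DH) (hcounit DH)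
                                          ract;
  mp_lact : is_left_hom_module_coalgebra DH beta (hcomul DB) (hcounit DB) lact;
  mp_mul_ract : forall h g a,
    (h *H g) <<| a =
    \sweedler_(g1, g2 <- hcomul DH g)
      \sweedler_(a1, a2 <- hcomul DB a)
        ((h <<| (g1 |>> betaV a1)) *H (alpha g2 <<| a2));
  mp_one_ract : forall a, hone DH <<| a = hcounit DB a *: hone DH;
  mp_lact_mul : forall h a b,
    h |>> (a *B b) =
    \sweedler_(h1, h2 <- hcomul DH h)
      \sweedler_(a1, a2 <- hcomul DB a)
        ((h1 |>> beta a1) *B ((alphaV h2 <<| a2) |>> b));
  mp_lact_one : forall h, h |>> hone DB = hcounit DH h *: hone DB;
  mp_exchange : forall h a,
    \sweedler_(h1, h2 <- hcomul DH h)
      \sweedler_(a1, a2 <- hcomul DB a) ((h1 <<| a1) *t (h2 |>> a2)) =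
    \sweedler_(h1, h2 <- hcomul DH h)
      \sweedler_(a1, a2 <- hcomul DB a) ((h2 <<| a2) *t (h1 |>> a1))
}.

Local Notation BH := (tensor B H).

Definition dc_twist : 'End(BH) := tlift (fun a h => beta a *t alpha h).

Definition dc_mul : 'Hom(tensor BH BH, BH) :=
  tlift (fun x y : BH =>
    \sweedler_(a, h <- x) \sweedler_(b, g <- y)
      \sweedler_(h1, h2 <- hcomul DH h)
        \sweedler_(b1, b2 <- hcomul DB b)
          ((a *B (h1 |>> b1)) *t ((h2 <<| b2) *H g))).

Definition dc_comul : 'Hom(BH, tensor BH BH) :=
  tlift (fun a h =>
    \sweedler_(a1, a2 <- hcomul DB a)
      \sweedler_(h1, h2 <- hcomul DH h) ((a1 *t h1) *t (a2 *t h2))).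

Definition dc_counit : 'Hom(BH, k^o) :=
  tlift (fun a h => (hcounit DB a : k) * hcounit DH h : k^o).

Definition dc_antipode : 'End(BH) :=
  tlift (fun a h =>
    \sweedler_(a1, a2 <- hcomul DB a)
      \sweedler_(h1, h2 <- hcomul DH h)
        ((S_H h2 |>> S_B a2) *t (S_H h1 <<| S_B a1))).

Definition double_cross_product : homHopfData BH :=
  HomHopfData dc_twist dc_mul (hone DB *t hone DH)
              dc_comul dc_counit dc_antipode.

(* The values on pure tensors, which determine the maps above. *)
Lemma dc_twistE a h : dc_twist (a *t h) = beta a *t alpha h.
Proof.
have [pl pr] := tensorp_bilinear B H.
by rewrite tlift_pure //; split=> [? ? ? ?|? ? ? ?]; rewrite linearP (pl, pr).
Qed.

Lemma dc_mulE a h b g :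
  dc_mul ((a *t h) *t (b *t g)) =
  \sweedler_(h1, h2 <- hcomul DH h)
    \sweedler_(b1, b2 <- hcomul DB b)
      ((a *B (h1 |>> b1)) *t ((h2 <<| b2) *H g)).
Proof.
have [pl pr] := tensorp_bilinear B H.
have [pBl pBr] := tensorp_bilinear B B.
have [pHl pHr] := tensorp_bilinear H H.
rewrite tlift_pure; last first.
  split=> [y c x1 x2|x c y1 y2]; first by rewrite linearP.
  by apply: tlift_comb => a' h'; rewrite linearP.
rewrite tlift_pure; last first.
  split=> [h' c a1 a2|a' c h1 h2]; apply: tlift_comb => b' g'; last first.
    by rewrite !linearP.
  apply: tlift_comb => h1 h2; apply: tlift_comb => b1 b2.
  by rewrite pBl linearP /= pl.
rewrite tlift_pure //.
split=> [g' c b1 b2|b' c g1 g2]; apply: tlift_comb => h1 h2.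
  by rewrite !linearP.
by apply: tlift_comb => b1 b2; rewrite pHr linearP /= pr.
Qed.

Lemma dc_comulE a h :
  dc_comul (a *t h) =
  \sweedler_(a1, a2 <- hcomul DB a)
    \sweedler_(h1, h2 <- hcomul DH h) ((a1 *t h1) *t (a2 *t h2)).
Proof.
rewrite tlift_pure //; split=> [h' c a1 a2|a' c h1 h2]; first by rewrite !linearP.
by apply: tlift_comb => a1 a2; rewrite !linearP.
Qed.

Lemma dc_counitE a h : dc_counit (a *t h) = hcounit DB a * hcounit DH h.
Proof.
rewrite tlift_pure //; split=> [h' c a1 a2|a' c h1 h2]; rewrite linearP /=.
  by rewrite mulrDl -mulrA.
by rewrite mulrDr mulrCA.
Qed.

Lemma dc_antipodeE a h :
  dc_antipode (a *t h) =
  \sweedler_(a1, a2 <- hcomul DB a)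
    \sweedler_(h1, h2 <- hcomul DH h)
      ((S_H h2 |>> S_B a2) *t (S_H h1 <<| S_B a1)).
Proof.
rewrite tlift_pure //; split=> [h' c a1 a2|a' c h1 h2]; first by rewrite !linearP.
by apply: tlift_comb => a1 a2; rewrite !linearP.
Qed.

End MatchedPair.

End HomStructures.

(* Main.v *)
Require Import Defs.
From HB Require Import structures.
From mathcomp Require Import all_boot all_order all_algebra.

(* Composing the structure maps of a monoidal Hom-Hopf algebra with powers of *)
(* its twist (mul' = alpha^-1 o mul, Delta' = Delta o alpha) yields an        *)
(* ordinary Hopf algebra, and composing the actions of a matched pair with    *)
(* the inverse twists yields an ordinary matched pair whose double cross      *)
(* product, twisted back by beta (x) alpha, is the one sought. It is thus     *)
(* enough to treat trivial twists. Then H (x) B is a coalgebra on which both  *)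
(* actions are coalgebra maps, so that, writing a # h for a (x) h,            *)
(*   (a # h)(b # g) = \sum a (lact p_1) # (ract p_2) g   with p = h (x) b;    *)
(* associativity and multiplicativity of Delta follow by coassociativity in   *)
(* p, the latter using the exchange condition on the two middle factors of    *)
(* the fourfold coproduct. Finally a # h = (a # 1)(1 # h), and as the         *)
(* antipodes reverse the coproducts, S (a # h) = (1 # S h)(S a # 1), which    *)
(* reduces the antipode axioms to those of B and H.                           *)

Set Implicit Arguments.
Unset Strict Implicit.
Unset Printing Implicit Defensive.

Import GRing.Theory.
Local Open Scope ring_scope.

(** * Sweedler calculus *)

(** Twisting a Hom-Hopf algebra by an automorphism [psi] (multiply products by [psi], precompose
    coproducts with its inverse) preserves the axioms: [twisted_hopf]. Taking for [psi] the inverse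
    of the structural twist gives an ordinary Hopf algebra, and [untwisted_pair] does the same to
    the matched pair. Twisting the ordinary double cross product by [beta] (x) [alpha] recovers
    exactly the required structure maps ([double_cross_product_twisted]), so the ordinary case
    [double_cross_product_ordinary] suffices. There, the carrying facts are [dc_mulA], by
    coassociativity on H (x) B; [dc_comulM], the one place where the exchange condition enters; and
    [dc_antipode_factor], which rests on [antipode_comul]. Sums are handled by linearity: an
    identity of linear maps is tested on pure tensors ([eq_tensor]), and an axiom stated as an
    equality of tensors is applied under an arbitrary multilinear summand. *)

Section SweedlerCalculus.

Variable k : fieldType.
Implicit Types U V W X : vectType k.

Lemma sweedlerE U V W (F : U -> V -> W) (t : tensor U V) :
  \sweedler_(x, y <- t) F x y =
  \sum_p (t : 'M_(_, _)) p.1 p.2 *: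
    F (vbasis {:U})`_p.1 (vbasis {:V})`_p.2.
Proof. by rewrite lfunE /= /tlift_fun pair_big. Qed.

Lemma eq_sweedler U V W (F G : U -> V -> W) (t : tensor U V) :
  (forall x y, F x y = G x y) ->
  \sweedler_(x, y <- t) F x y = \sweedler_(x, y <- t) G x y.
Proof. by move=> FG; rewrite !sweedlerE; apply: eq_bigr => p _; rewrite FG. Qed.

Lemma sweedler_linear U V W X (g : W -> X) (F : U -> V -> W)
    (t : tensor U V) : linear g ->
  g (\sweedler_(x, y <- t) F x y) = \sweedler_(x, y <- t) g (F x y).
Proof.
move=> lin_g; pose h : {linear W -> X} :=
  HB.pack g (GRing.isLinear.Build _ _ _ _ g lin_g).
rewrite !sweedlerE -[LHS]/(h _) linear_sum.
by apply: eq_bigr => p _; rewrite linearZ.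
Qed.

Lemma sweedler_exchange U V U' V' W (F : U -> V -> U' -> V' -> W)
    (s : tensor U V) (t : tensor U' V') :
  \sweedler_(x, y <- s) \sweedler_(z, w <- t) F x y z w =
  \sweedler_(z, w <- t) \sweedler_(x, y <- s) F x y z w.
Proof.
rewrite !sweedlerE; under eq_bigr do rewrite sweedlerE scaler_sumr.
rewrite exchange_big; apply: eq_bigr => q _.
rewrite sweedlerE scaler_sumr; apply: eq_bigr => p _.
by rewrite !scalerA mulrC.
Qed.

Lemma linear_id U : linear (fun u : U => u). Proof. by []. Qed.

Lemma linear_hom U V W (g : 'Hom(V, W)) (f : U -> V) :
  linear f -> linear (fun u => g (f u)).
Proof. by move=> lf a u v; rewrite lf linearP. Qed.

Lemma linear_lfun U V (g : 'Hom(U, V)) : linear g.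
Proof. by move=> a u v; rewrite linearP. Qed.

Lemma linear_funZ U V (f : U -> V) a u : linear f -> f (a *: u) = a *: f u.
Proof.
move=> lf; have f0 : f 0 = 0.
  by have := lf (-1) 0 0; rewrite scaler0 addr0 scaleN1r addNr.
by rewrite -[a *: u]addr0 lf f0 addr0.
Qed.

Lemma tensorZl U V a (u : U) (v : V) : (a *: u) *t v = a *: (u *t v).
Proof. by apply/matrixP=> i j; rewrite !mxE linearZ -mulrA. Qed.

Lemma tensorZr U V a (u : U) (v : V) : u *t (a *: v) = a *: (u *t v).
Proof. by apply/matrixP=> i j; rewrite !mxE linearZ mulrCA. Qed.

Lemma linear_tensorl U V W (f : U -> V) (w : W) :
  linear f -> linear (fun u => f u *t w).
Proof. by move=> lf a u v; rewrite lf (tensorp_bilinear _ _).1. Qed.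

Lemma linear_tensorr U V W (f : U -> W) (v : V) :
  linear f -> linear (fun u => v *t f u).
Proof. by move=> lf a u w; rewrite lf (tensorp_bilinear _ _).2. Qed.

Lemma linear_scalel U W (f : U -> k^o) (w : W) :
  linear f -> linear (fun u => (f u : k) *: w).
Proof. by move=> lf a u v; rewrite lf scalerDl scalerA. Qed.

Lemma linear_scaler U W (c : k) (f : U -> W) :
  linear f -> linear (fun u => c *: f u).
Proof. by move=> lf a u v; rewrite lf scalerDr !scalerA mulrC. Qed.

Lemma linear_mull U (f : U -> k^o) (c : k) :
  linear f -> linear (fun u => (f u : k) * c : k^o).
Proof.
by move=> lf a u v; rewrite lf mulrDl -[LHS]/(_ *: _ * _ + _) -scalerAl.
Qed.

Lemma linear_mulr U (f : U -> k^o) (c : k) :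
  linear f -> linear (fun u => c * (f u : k) : k^o).
Proof.
by move=> lf a u v; rewrite lf mulrDr; congr (_ + _); rewrite [LHS]mulrCA.
Qed.

Lemma linear_sweedler U V W X (F : U -> V -> W -> X) (t : tensor V W) :
  (forall x y, linear (fun u => F u x y)) ->
  linear (fun u => \sweedler_(x, y <- t) F u x y).
Proof. by move=> lF a u v; apply: tlift_comb => x y; apply: lF. Qed.

(** Multilinearity is kept as a predicate on plain functions, so that the summand of any Sweedler
    sum can be tested without packaging it as a morphism. *)
Definition bilinearf U V W (F : U -> V -> W) :=
  (forall v, linear (fun u => F u v)) /\ (forall u, linear (F u)).

Definition trilinearf U V W X (F : U -> V -> W -> X) :=
  (forall w, bilinearf (fun u v => F u v w)) /\ (forall u v, linear (F u v)).

(** Version of [tlift_unique] for unbundled functions; it is what reduces a goal about a tensor to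
    pure tensors. *)
Lemma eq_tensor U V W (f g : tensor U V -> W) : linear f -> linear g ->
  (forall u v, f (u *t v) = g (u *t v)) -> f =1 g.
Proof.
move=> lf lg fg t; rewrite (tensor_sum_pure t).
pose f' : {linear _ -> _} := HB.pack f (GRing.isLinear.Build _ _ _ _ f lf).
pose g' : {linear _ -> _} := HB.pack g (GRing.isLinear.Build _ _ _ _ g lg).
rewrite -[LHS]/(f' _) -[RHS]/(g' _) !linear_sum; apply: eq_bigr => i _.
by rewrite !linear_sum; apply: eq_bigr => j _; rewrite !linearZ /= fg.
Qed.

Lemma linear_bilinl U V W X (F : U -> V -> W) (f : X -> U) v :
  bilinearf F -> linear f -> linear (fun u => F (f u) v).
Proof. by move=> [lF _] lf a x y; rewrite lf lF. Qed.

Lemma linear_bilinr U V W X (F : U -> V -> W) (f : X -> V) u :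
  bilinearf F -> linear f -> linear (fun v => F u (f v)).
Proof. by move=> [_ lF] lf a x y; rewrite lf lF. Qed.

Lemma sweedler_pure U V W (F : U -> V -> W) u v :
  bilinearf F -> \sweedler_(x, y <- u *t v) F x y = F u v.
Proof. by case=> Fl Fr; apply: tlift_pure; split. Qed.

Lemma sweedler_tensorp U V (t : tensor U V) :
  \sweedler_(x, y <- t) (x *t y) = t.
Proof.
move: t; apply: eq_tensor => [||u v]; [exact: linear_lfun|exact: linear_id|].
by rewrite tlift_pure //; apply: tensorp_bilinear.
Qed.

(** Substitution rule: it allows a formula for a coproduct, itself a Sweedler sum of pure tensors,
    to be used inside another Sweedler sum. *)
Lemma sweedler_sweedler U V U' V' W (X : U -> V -> U') (Y : U -> V -> V')
    (F : U' -> V' -> W) (t : tensor U V) : bilinearf F ->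
  \sweedler_(x, y <- \sweedler_(u, v <- t) (X u v *t Y u v)) F x y =
  \sweedler_(u, v <- t) F (X u v) (Y u v).
Proof.
move=> bF; rewrite (sweedler_linear (g := tlift _)).
  by apply: eq_sweedler => u v; rewrite sweedler_pure.
exact: linear_lfun.
Qed.

End SweedlerCalculus.

(** Proves the multilinearity side conditions by following the syntax of the summand; an abstract
    summand is handled through a [bilinearf] hypothesis of the context. *)
Ltac lin := lazymatch goal with
  | |- forall _, _ => move=> ?; lin
  | |- trilinearf _ => split; [move=> ?; lin | move=> ? ?; lin]
  | |- bilinearf _ => split; move=> ?; lin
  | |- _ => cbv beta; first
    [ apply: linear_id | apply: linear_lfun
    | apply: linear_tensorl; lin | apply: linear_tensorr; lin
    | apply: linear_sweedler => ? ?; lin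
    | apply: linear_scalel; lin | apply: linear_scaler; lin
    | apply: linear_mull; lin | apply: linear_mulr; lin
    | apply: linear_hom; lin
    | match goal with bF : bilinearf ?F |- _ => first
        [ apply: (linear_bilinl _ bF); lin
        | apply: (linear_bilinr _ bF); lin ] end ]
end.

Lemma lfunK (k : fieldType) (U V : vectType k) (f : 'Hom(U, V)) :
  bijective f -> cancel f (f^-1)%VF.
Proof. by move=> bij_f; apply/lker0_lfunK/lker0P/bij_inj. Qed.

Lemma lfunVK (k : fieldType) (U : vectType k) (f : 'End(U)) :
  bijective f -> cancel (f^-1)%VF f.
Proof. by move=> bij_f; apply/lker0_lfunVK/lker0P/bij_inj. Qed.

Lemma inv_lfun_can (k : fieldType) (U : vectType k) (f g : 'End(U)) :
  cancel f g -> cancel g f -> (f^-1 = g)%VF.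
Proof.
move=> fK gK; apply/lfunP => u.
by rewrite -{1}(gK u) lfunK //; exists g.
Qed.

Lemma inv_id_lfun (k : fieldType) (U : vectType k) (u : U) :
  ((\1 : 'End(U))^-1)%VF u = u.
Proof. by rewrite (@inv_lfun_can _ _ _ \1%VF) => [|x|x]; rewrite !id_lfunE. Qed.

(** A trilinear [F] factors through a linear map [G] on C (x) (C (x) C), and [G] is applied to both
    sides of the axiom. *)
Lemma sweedler_hom_coassoc (k : fieldType) (C : vectType k) (gamma : 'End(C))
    (Delta : 'Hom(C, tensor C C)) (eps : 'Hom(C, k^o)) (W : vectType k)
    (F : C -> C -> C -> W) c :
  is_hom_coalgebra gamma Delta eps -> trilinearf F ->
  \sweedler_(x, y <- Delta c)
    \sweedler_(z, w <- Delta y) F ((gamma^-1)%VF x) z w =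
  \sweedler_(x, y <- Delta c)
    \sweedler_(z, w <- Delta x) F z w ((gamma^-1)%VF y).
Proof.
move=> coalgC [bF lF].
pose G := tlift (fun x p => \sweedler_(y, z <- p) F x y z).
have GE x y z : G (x *t (y *t z)) = F x y z.
  rewrite /G !sweedler_pure //; split=> [?|u].
  - exact: (bF _).2.
  - exact: lF.
  - by apply: linear_sweedler => ? ?; apply: (bF _).1.
  - by lin.
have lG : linear G by exact: linear_lfun.
have := congr1 G (hc_coassoc coalgC c); rewrite !(sweedler_linear _ _ lG).
under eq_sweedler => x y do rewrite (sweedler_linear _ _ lG).
under [in RHS]eq_sweedler => x y do rewrite (sweedler_linear _ _ lG).
move=> E; etransitivity; last (etransitivity; first exact: E).
  by do 2!apply: eq_sweedler => ? ?; rewrite GE.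
by do 2!apply: eq_sweedler => ? ?; rewrite GE.
Qed.

(** * Coassociativity and counit rules for coalgebras with trivial twist *)

Section OrdinaryCoalgebra.

Variables (k : fieldType) (C : vectType k).
Variables (Delta : 'Hom(C, tensor C C)) (eps : 'Hom(C, k^o)).
Hypothesis coalgC : is_hom_coalgebra \1%VF Delta eps.

Lemma sweedler_coassoc (W : vectType k) (F : C -> C -> C -> W) c :
  trilinearf F ->
  \sweedler_(x, y <- Delta c) \sweedler_(z, w <- Delta y) F x z w =
  \sweedler_(x, y <- Delta c) \sweedler_(z, w <- Delta x) F z w y.
Proof.
move=> tF; have := sweedler_hom_coassoc c coalgC tF.
under eq_sweedler do under eq_sweedler do rewrite inv_id_lfun.
by under [in RHS]eq_sweedler do under eq_sweedler do rewrite inv_id_lfun.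
Qed.

(** Regroups the fourfold coproduct from (c1 c2)(c3 c4) to c1 (c2 c3) c4, so that the two middle
    factors come from a single coproduct and an identity about one coproduct applies to them. *)
Lemma sweedler_coassoc4 (W : vectType k) (F : C -> C -> C -> C -> W) c :
    trilinearf (fun x y z => \sweedler_(v, w <- Delta z) F x y v w) ->
    (forall x, trilinearf (F x)) ->
  \sweedler_(x, y <- Delta c)
    \sweedler_(t, u <- Delta x) \sweedler_(v, w <- Delta y) F t u v w =
  \sweedler_(x, y <- Delta c)
    \sweedler_(t, w <- Delta y) \sweedler_(u, v <- Delta t) F x u v w.
Proof.
move=> tF3 tF; rewrite -(sweedler_coassoc _ tF3); apply: eq_sweedler => x y.
exact: sweedler_coassoc.
Qed.

Lemma sweedler_counitl (W : vectType k) (F : C -> W) c : linear F ->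
  \sweedler_(x, y <- Delta c) (eps x *: F y) = F c.
Proof.
move=> lF; rewrite -[in RHS](inv_id_lfun c) -(hc_counitl coalgC).
rewrite sweedler_linear //; apply: eq_sweedler => x y.
by rewrite linear_funZ.
Qed.

Lemma sweedler_counitr (W : vectType k) (F : C -> W) c : linear F ->
  \sweedler_(x, y <- Delta c) (eps y *: F x) = F c.
Proof.
move=> lF; rewrite -[in RHS](inv_id_lfun c) -(hc_counitr coalgC).
rewrite sweedler_linear //; apply: eq_sweedler => x y.
by rewrite linear_funZ.
Qed.

End OrdinaryCoalgebra.

(** * Tensor product of two ordinary coalgebras *)

Section TensorCoalgebra.

Variables (k : fieldType) (C D : vectType k).
Variables (DC : homHopfData C) (DD : homHopfData D).
Hypothesis coalgC : is_hom_coalgebra \1%VF (hcomul DC) (hcounit DC).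
Hypothesis coalgD : is_hom_coalgebra \1%VF (hcomul DD) (hcounit DD).

Lemma sweedler_dc_comul (W : vectType k) (F : tensor C D -> tensor C D -> W)
    c d : bilinearf F ->
  \sweedler_(p, q <- dc_comul DC DD (c *t d)) F p q =
  \sweedler_(c1, c2 <- hcomul DC c) \sweedler_(d1, d2 <- hcomul DD d)
    F (c1 *t d1) (c2 *t d2).
Proof.
move=> bF; rewrite dc_comulE (sweedler_linear (g := tlift _)); last first.
  exact: linear_lfun.
by apply: eq_sweedler => x y; rewrite sweedler_sweedler.
Qed.

(** Needed for both orders of the factors: B (x) H carries the double cross product, H (x) B is the
    source of the two actions. *)
Lemma dc_coalgebra :
  is_hom_coalgebra \1%VF (dc_comul DC DD) (dc_counit DC DD).
Proof.
split=> [|p|p|p|p|p]; rewrite ?id_lfunE ?inv_id_lfun //.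
- by exists id => x; rewrite id_lfunE.
- move: p; apply: eq_tensor => [||c d]; [lin|lin|].
  rewrite !sweedler_dc_comul; try lin.
  under eq_sweedler => c1 c2.
    under eq_sweedler => d1 d2.
      rewrite sweedler_dc_comul; last by lin.
      over.
    rewrite sweedler_exchange.
    under eq_sweedler => c3 c4.
      rewrite (sweedler_coassoc coalgD (F := fun x y z =>
        _ (c1 *t x) *t ((c3 *t y) *t (c4 *t z)))); last by lin.
      over.
    over.
  rewrite (sweedler_coassoc coalgC); last by lin.
  apply: eq_sweedler => c1 c2; rewrite sweedler_exchange.
  apply: eq_sweedler => d1 d2; rewrite sweedler_dc_comul; last by lin.
  do 2!apply: eq_sweedler => ? ?; by rewrite !inv_id_lfun.
- move: p; apply: eq_tensor => [||c d]; [lin|lin|].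
  rewrite sweedler_dc_comul; last by lin.
  under eq_sweedler => c1 c2.
    under eq_sweedler => d1 d2 do rewrite dc_counitE -scalerA.
    rewrite -(sweedler_linear (g := fun x => _ *: x)); last by lin.
    rewrite (sweedler_counitr coalgD (F := fun x => c1 *t x)); last by lin.
    over.
  by rewrite (sweedler_counitr coalgC (F := fun x => x *t d)); last by lin.
- move: p; apply: eq_tensor => [||c d]; [lin|lin|].
  rewrite sweedler_dc_comul; last by lin.
  under eq_sweedler => c1 c2.
    under eq_sweedler => d1 d2 do rewrite dc_counitE -scalerA.
    rewrite -(sweedler_linear (g := fun x => _ *: x)); last by lin.
    rewrite (sweedler_counitl coalgD (F := fun x => c2 *t x)); last by lin.
    over.
  by rewrite (sweedler_counitl coalgC (F := fun x => x *t d)); last by lin.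
- under [RHS]eq_sweedler do rewrite !id_lfunE.
  move: p; apply: eq_tensor => [||c d]; [lin|lin|].
  by rewrite sweedler_dc_comul ?dc_comulE //; lin.
Qed.

End TensorCoalgebra.

(** * Convolution inverses and the antipode *)

Section ConvolutionInverse.

Variables (k : fieldType) (C A : vectType k).
Variables (Delta : 'Hom(C, tensor C C)) (eps : 'Hom(C, k^o)).
Variables (mul : A -> A -> A) (one : A).
Hypothesis coalgC : is_hom_coalgebra \1%VF Delta eps.
Hypotheses (bil_mul : bilinearf mul) (mulA : associative mul).
Hypotheses (mul1 : right_id one mul) (mul1l : left_id one mul).

(** For the convolution product, [L = L (T R) = (L T) R = R]. *)
Lemma convolution_inverse_unique (L T R : 'Hom(C, A)) :
    (forall c, \sweedler_(x, y <- Delta c) mul (L x) (T y) = eps c *: one) ->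
    (forall c, \sweedler_(x, y <- Delta c) mul (T x) (R y) = eps c *: one) ->
  forall c, L c = R c.
Proof.
move=> LT TR c.
rewrite -(sweedler_counitr coalgC (F := L)); last by lin.
rewrite -[RHS](sweedler_counitl coalgC (F := R)); last by lin.
transitivity (\sweedler_(x, y <- Delta c) \sweedler_(z, w <- Delta y)
   mul (L x) (mul (T z) (R w))).
  apply: eq_sweedler => x y.
  rewrite -(sweedler_linear (g := mul (L x))); last exact: bil_mul.2.
  by rewrite TR linear_funZ ?mul1 //; apply: bil_mul.2.
rewrite (sweedler_coassoc coalgC); last by lin.
apply: eq_sweedler => x y; under eq_sweedler do rewrite mulA.
rewrite -(sweedler_linear (g := mul^~ (R y))); last exact: bil_mul.1.
rewrite LT (linear_funZ (f := mul^~ (R y))) ?mul1l //; exact: bil_mul.1.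
Qed.

End ConvolutionInverse.

Section Antipode.

Variables (k : fieldType) (H : vectType k) (D : homHopfData H).
Hypotheses (hopfD : is_hom_hopf_algebra D) (twistD : htwist D = \1%VF).

Local Notation "h ** g" := (hmul D (h *t g)) (at level 39).
Local Notation Delta := (hcomul D).
Local Notation S := (hantipode D).

Lemma hopf_coalgebra : is_hom_coalgebra \1%VF Delta (hcounit D).
Proof. by rewrite -twistD; apply: hb_coalg (hh_bialg hopfD). Qed.

Lemma hopf_mulA a b c : a ** (b ** c) = (a ** b) ** c.
Proof.
by have := ha_assoc (hb_alg (hh_bialg hopfD)) a b c; rewrite twistD !id_lfunE.
Qed.

Lemma hopf_mul1 a : a ** hone D = a.
Proof.
by rewrite (ha_mul1 (hb_alg (hh_bialg hopfD))) twistD id_lfunE.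
Qed.

Lemma hopf_1mul a : hone D ** a = a.
Proof.
by rewrite (ha_1mul (hb_alg (hh_bialg hopfD))) twistD id_lfunE.
Qed.

(** In the convolution algebra of maps from H to H (x) H, the left side is a left inverse of [Delta]
    and the right side a right inverse, so they coincide. *)
Lemma antipode_comul h :
  Delta (S h) = \sweedler_(h1, h2 <- Delta h) (S h2 *t S h1).
Proof.
have coalgD := hopf_coalgebra.
pose m (s t : tensor H H) : tensor H H :=
  \sweedler_(x, y <- s) \sweedler_(z, w <- t) ((x ** z) *t (y ** w)).
have bil_m : bilinearf m by rewrite /m; lin.
have mE x y z w : m (x *t y) (z *t w) = (x ** z) *t (y ** w).
  by rewrite /m !sweedler_pure //; lin.
have mA : associative m.
  move=> + + t => x y.
  move: x; apply: eq_tensor => [||x1 x2]; [lin|lin|].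
  move: y; apply: eq_tensor => [||y1 y2]; [lin|lin|].
  move: t; apply: eq_tensor => [||z1 z2]; [lin|lin|].
  by rewrite !mE !hopf_mulA.
have m1 : right_id (hone D *t hone D) m.
  by apply: eq_tensor => [||x1 x2]; [lin|lin|rewrite mE !hopf_mul1].
have m1l : left_id (hone D *t hone D) m.
  by apply: eq_tensor => [||x1 x2]; [lin|lin|rewrite mE !hopf_1mul].
pose L := (Delta \o S)%VF.
pose R := (tlift (fun x y => S y *t S x) \o Delta)%VF.
have := convolution_inverse_unique (T := Delta) coalgD bil_m mA m1 m1l.
move=> /(_ L R) LR; suff: L h = R h by rewrite !comp_lfunE.
have antiS := hh_antipode hopfD.
apply: LR => c.
  under eq_sweedler => x y.
    rewrite comp_lfunE /= -[m _ _](hb_comulM (hh_bialg hopfD)).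
    over.
  rewrite -(sweedler_linear (g := Delta)); last exact: linear_lfun.
  by rewrite (anti_mull antiS) linearZ /= (hb_comul1 (hh_bialg hopfD)).
under eq_sweedler => x y.
  rewrite comp_lfunE /= /m.
  under eq_sweedler => u v.
    rewrite sweedler_sweedler; last by lin.
    over.
  over.
(* The sum is h1 S(h4) (x) h2 S(h3): the inner pair h2, h3 is collapsed first, then the outer
   pair. *)
rewrite (sweedler_coassoc4 coalgD (F := fun x y z w =>
  (x ** S w) *t (y ** S z))); [|lin|lin].
under eq_sweedler => x y.
  under eq_sweedler => u v.
    rewrite -(sweedler_linear (g := fun z => _ *t z)); last by lin.
    rewrite (anti_mulr antiS) tensorZr.
    over.
  rewrite (sweedler_counitl coalgD (F := fun z => (x ** S z) *t _));
    last by lin.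
  over.
rewrite -(sweedler_linear (g := fun z => z *t _)); last by lin.
by rewrite (anti_mulr antiS) tensorZl.
Qed.

End Antipode.

(** * Matched pairs with trivial twists *)

Section OrdinaryMatchedPair.

Variables (k : fieldType) (B H : vectType k).
Variables (DB : homHopfData B) (DH : homHopfData H).
Variables (ract : 'Hom(tensor H B, H)) (lact : 'Hom(tensor H B, B)).
Hypothesis pairBH : is_matched_pair DB DH ract lact.
Hypotheses (twistB : htwist DB = \1%VF) (twistH : htwist DH = \1%VF).

Local Notation "h *H g" := (hmul DH (h *t g)) (at level 39).
Local Notation "a *B b" := (hmul DB (a *t b)) (at level 39).
Local Notation M := (dc_mul DB DH ract lact).
(* The coproduct of the coalgebra H (x) B, on which both actions are defined; *)
(* the factors are in the opposite order to those of B (x) H.                 *)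
Local Notation DeltaP := (dc_comul DH DB).

Let hopfB := mp_hopfB pairBH.
Let hopfH := mp_hopfH pairBH.
Let bialgB := hh_bialg hopfB.
Let bialgH := hh_bialg hopfH.
Let coalgB := hopf_coalgebra hopfB twistB.
Let coalgH := hopf_coalgebra hopfH twistH.
Let coalgP := dc_coalgebra coalgH coalgB.
Let mulBA := hopf_mulA hopfB twistB.
Let mulHA := hopf_mulA hopfH twistH.

(** * Matched-pair axioms rewritten in terms of the coalgebra H (x) B *)

Lemma sweedler_lact (W : vectType k) (F : B -> B -> W) p : bilinearf F ->
  \sweedler_(x, y <- hcomul DB (lact p)) F x y =
  \sweedler_(p1, p2 <- DeltaP p) F (lact p1) (lact p2).
Proof.
move=> bF; move: p; apply: eq_tensor => [||h a]; [lin|lin|].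
rewrite (lmc_comul (mp_lact pairBH)) sweedler_dc_comul; last by lin.
rewrite sweedler_linear; last exact: linear_lfun.
by apply: eq_sweedler => ? ?; rewrite sweedler_sweedler.
Qed.

Lemma sweedler_ract (W : vectType k) (F : H -> H -> W) p : bilinearf F ->
  \sweedler_(x, y <- hcomul DH (ract p)) F x y =
  \sweedler_(p1, p2 <- DeltaP p) F (ract p1) (ract p2).
Proof.
move=> bF; move: p; apply: eq_tensor => [||h a]; [lin|lin|].
rewrite (rmc_comul (mp_ract pairBH)) sweedler_dc_comul; last by lin.
rewrite sweedler_linear; last exact: linear_lfun.
by apply: eq_sweedler => ? ?; rewrite sweedler_sweedler.
Qed.

Lemma sweedler_mulB (W : vectType k) (F : B -> B -> W) a b : bilinearf F ->
  \sweedler_(x, y <- hcomul DB (a *B b)) F x y =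
  \sweedler_(a1, a2 <- hcomul DB a) \sweedler_(b1, b2 <- hcomul DB b)
    F (a1 *B b1) (a2 *B b2).
Proof.
move=> bF; rewrite (hb_comulM (hh_bialg (mp_hopfB pairBH))).
rewrite sweedler_linear; last exact: linear_lfun.
by apply: eq_sweedler => ? ?; rewrite sweedler_sweedler.
Qed.

Lemma sweedler_mulH (W : vectType k) (F : H -> H -> W) a b : bilinearf F ->
  \sweedler_(x, y <- hcomul DH (a *H b)) F x y =
  \sweedler_(a1, a2 <- hcomul DH a) \sweedler_(b1, b2 <- hcomul DH b)
    F (a1 *H b1) (a2 *H b2).
Proof.
move=> bF; rewrite (hb_comulM (hh_bialg (mp_hopfH pairBH))).
rewrite sweedler_linear; last exact: linear_lfun.
by apply: eq_sweedler => ? ?; rewrite sweedler_sweedler.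
Qed.

Lemma sweedler_matched (W : vectType k) (F : H -> B -> W) p : bilinearf F ->
  \sweedler_(p1, p2 <- DeltaP p) F (ract p1) (lact p2) =
  \sweedler_(p1, p2 <- DeltaP p) F (ract p2) (lact p1).
Proof.
move=> bF; move: p; apply: eq_tensor => [||h a]; [lin|lin|].
rewrite !sweedler_dc_comul; try lin.
have := congr1 (tlift F) (mp_exchange pairBH h a).
rewrite !(sweedler_linear _ _ (@linear_lfun _ _ _ (tlift _))).
under eq_sweedler do rewrite sweedler_sweedler //.
by under [in RHS]eq_sweedler do rewrite sweedler_sweedler //.
Qed.

Lemma lact_mull h g b : lact ((h *H g) *t b) = lact (h *t lact (g *t b)).
Proof.
have := lm_assoc (lmc_mod (mp_lact pairBH)) h g b.
by rewrite twistB twistH !id_lfunE.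
Qed.

Lemma ract_mulr h a b : ract (h *t (a *B b)) = ract (ract (h *t a) *t b).
Proof.
have := rm_assoc (rmc_mod (mp_ract pairBH)) h a b.
by rewrite twistB twistH !id_lfunE.
Qed.

Lemma ract_mull h g a :
  ract ((h *H g) *t a) =
  \sweedler_(p1, p2 <- DeltaP (g *t a)) (ract (h *t lact p1) *H ract p2).
Proof.
rewrite (mp_mul_ract pairBH) sweedler_dc_comul; last by lin.
by do 2!apply: eq_sweedler => ? ?; rewrite twistB twistH inv_id_lfun id_lfunE.
Qed.

Lemma lact_mulr h a b :
  lact (h *t (a *B b)) =
  \sweedler_(p1, p2 <- DeltaP (h *t a)) (lact p1 *B lact (ract p2 *t b)).
Proof.
rewrite (mp_lact_mul pairBH) sweedler_dc_comul; last by lin.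
by do 2!apply: eq_sweedler => ? ?; rewrite twistB twistH inv_id_lfun id_lfunE.
Qed.

(** * Associativity and unit of the double cross product *)

Lemma dc_mulEP a h b g :
  M ((a *t h) *t (b *t g)) =
  \sweedler_(p1, p2 <- DeltaP (h *t b)) ((a *B lact p1) *t (ract p2 *H g)).
Proof. by rewrite dc_mulE sweedler_dc_comul //; lin. Qed.

(** This and [sweedler_actions_mulr] give the sums produced by an iterated product, where one of the
    acting arguments is itself a product. *)
Lemma sweedler_actions_mull (W : vectType k) (F : B -> H -> W) h g c :
  bilinearf F ->
  \sweedler_(q1, q2 <- DeltaP ((h *H g) *t c)) F (lact q1) (ract q2) =
  \sweedler_(h1, h2 <- hcomul DH h) \sweedler_(r1, r2 <- DeltaP (g *t c))
    \sweedler_(s1, s2 <- DeltaP r2)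
      F (lact (h1 *t lact r1)) (ract (h2 *t lact s1) *H ract s2).
Proof.
move=> bF; rewrite sweedler_dc_comul; last by lin.
rewrite sweedler_mulH; last by lin.
apply: eq_sweedler => h1 h2; rewrite sweedler_dc_comul; last by lin.
apply: eq_sweedler => g1 g2; apply: eq_sweedler => c1 c2.
by rewrite lact_mull ract_mull (sweedler_linear (g := F _)); last by lin.
Qed.

Lemma sweedler_actions_mulr (W : vectType k) (F : B -> H -> W) h b y :
  bilinearf F ->
  \sweedler_(q1, q2 <- DeltaP (h *t (b *B y))) F (lact q1) (ract q2) =
  \sweedler_(p1, p2 <- DeltaP (h *t b)) \sweedler_(y1, y2 <- hcomul DB y)
    \sweedler_(s1, s2 <- DeltaP p1)
      F (lact s1 *B lact (ract s2 *t y1)) (ract (ract p2 *t y2)).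
Proof.
move=> bF; rewrite !sweedler_dc_comul; try lin.
apply: eq_sweedler => h1 h2; rewrite sweedler_mulB; last by lin.
apply: eq_sweedler => b1 b2; apply: eq_sweedler => y1 y2.
rewrite lact_mulr ract_mulr (sweedler_linear (g := F^~ _)) //.
by lin.
Qed.

Lemma dc_mulA_pure a h b g c f :
  M ((a *t h) *t M ((b *t g) *t (c *t f))) =
  M (M ((a *t h) *t (b *t g)) *t (c *t f)).
Proof.
rewrite [M ((a *t h) *t (b *t g))]dc_mulEP [M ((b *t g) *t (c *t f))]dc_mulEP.
rewrite (sweedler_linear (g := fun x => M (x *t _))); last by lin.
rewrite (sweedler_linear (g := fun x => M (_ *t x))); last by lin.
transitivity
  (\sweedler_(p1, p2 <- DeltaP (h *t b)) \sweedler_(t1, t2 <- DeltaP p2)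
   \sweedler_(r1, r2 <- DeltaP (g *t c)) \sweedler_(s1, s2 <- DeltaP r2)
     (((a *B lact p1) *B lact (ract t1 *t lact r1)) *t
      ((ract (ract t2 *t lact s1) *H ract s2) *H f))); last first.
  apply: eq_sweedler => p1 p2; rewrite dc_mulEP.
  rewrite (sweedler_actions_mull (F := fun x y => ((a *B _) *B x) *t (y *H f)));
    last by lin.
  by rewrite sweedler_ract //; lin.
transitivity
  (\sweedler_(r1, r2 <- DeltaP (g *t c)) \sweedler_(p1, p2 <- DeltaP (h *t b))
   \sweedler_(u1, u2 <- DeltaP r1) \sweedler_(s1, s2 <- DeltaP p1)
     ((a *B (lact s1 *B lact (ract s2 *t lact u1))) *t
      (ract (ract p2 *t lact u2) *H (ract r2 *H f)))).
  apply: eq_sweedler => r1 r2; rewrite dc_mulEP.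
  rewrite (sweedler_actions_mulr (F := fun x y => (a *B x) *t (y *H _)));
    last by lin.
  apply: eq_sweedler => p1 p2.
  by rewrite sweedler_lact //; lin.
(* The two sides now differ only by the bracketing of the threefold coproducts of h (x) b and g (x)
   c, and of the products in B and H. *)
rewrite [RHS](sweedler_coassoc coalgP); last by lin.
rewrite sweedler_exchange; apply: eq_sweedler => p1 p2.
under eq_sweedler do rewrite sweedler_exchange.
rewrite sweedler_exchange; apply: eq_sweedler => s1 s2.
rewrite [RHS](sweedler_coassoc coalgP); last by lin.
by do 2!apply: eq_sweedler => ? ?; rewrite mulBA mulHA.
Qed.

Lemma dc_mulA x y z : M (x *t M (y *t z)) = M (M (x *t y) *t z).
Proof.
move: x; apply: eq_tensor => [||a h]; [lin|lin|].
move: y; apply: eq_tensor => [||b g]; [lin|lin|].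
move: z; apply: eq_tensor => [||c f]; [lin|lin|].
exact: dc_mulA_pure.
Qed.

Lemma ract_one h : ract (h *t hone DB) = h.
Proof. by rewrite (rm_act1 (rmc_mod (mp_ract pairBH))) twistH id_lfunE. Qed.

Lemma one_lact b : lact (hone DH *t b) = b.
Proof. by rewrite (lm_1act (lmc_mod (mp_lact pairBH))) twistB id_lfunE. Qed.

(** The action on the unit is a counit, so the coproduct of [h] collapses. With [dc_mul_unitl] this
    makes products involving one factor of B or H computable without actions. *)
Lemma dc_mul_unitr a h g :
  M ((a *t h) *t (hone DB *t g)) = a *t (h *H g).
Proof.
rewrite dc_mulE (hb_comul1 bialgB).
under eq_sweedler => h1 h2.
  rewrite sweedler_pure; last by lin.
  rewrite ract_one (mp_lact_one pairBH) tensorZr linearZ /= hopf_mul1 //.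
  rewrite tensorZl.
  over.
by rewrite (sweedler_counitl coalgH (F := fun x => a *t (x *H g))); last by lin.
Qed.

Lemma dc_mul_unitl a b g :
  M ((a *t hone DH) *t (b *t g)) = (a *B b) *t g.
Proof.
rewrite dc_mulE (hb_comul1 bialgH) sweedler_pure; last by lin.
under eq_sweedler => b1 b2.
  rewrite one_lact (mp_one_ract pairBH) tensorZl linearZ /= hopf_1mul //.
  rewrite tensorZr.
  over.
by rewrite (sweedler_counitr coalgB (F := fun x => (a *B x) *t g)); last by lin.
Qed.

Lemma dc_mul1 x : M (x *t (hone DB *t hone DH)) = x.
Proof.
move: x; apply: eq_tensor => [||a h]; [lin|lin|].
by rewrite dc_mul_unitr hopf_mul1.
Qed.

Lemma dc_1mul x : M ((hone DB *t hone DH) *t x) = x.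
Proof.
move: x; apply: eq_tensor => [||a h]; [lin|lin|].
by rewrite dc_mul_unitl hopf_1mul.
Qed.

(** * Bialgebra axioms and antipode *)

Lemma dc_comulM x y :
  dc_comul DB DH (M (x *t y)) =
  \sweedler_(x1, x2 <- dc_comul DB DH x)
    \sweedler_(y1, y2 <- dc_comul DB DH y) (M (x1 *t y1) *t M (x2 *t y2)).
Proof.
move: x; apply: eq_tensor => [||a h]; [lin|lin|].
move: y; apply: eq_tensor => [||b g]; [lin|lin|].
pose K a1 a2 g1 g2 x y z w :=
  ((a1 *B x) *t (y *H g1)) *t ((a2 *B z) *t (w *H g2)).
transitivity
  (\sweedler_(a1, a2 <- hcomul DB a) \sweedler_(g1, g2 <- hcomul DH g)
   \sweedler_(p, q <- DeltaP (h *t b))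
   \sweedler_(p1, p2 <- DeltaP p) \sweedler_(q1, q2 <- DeltaP q)
     K a1 a2 g1 g2 (lact p1) (ract q1) (lact p2) (ract q2)).
  rewrite dc_mulEP (sweedler_linear (g := dc_comul DB DH)); last by lin.
  under eq_sweedler => p q.
    rewrite dc_comulE sweedler_mulB; last by lin.
    under eq_sweedler => a1 a2.
      rewrite sweedler_lact; last by lin.
      under eq_sweedler => p1 p2.
        rewrite sweedler_mulH; last by lin.
        rewrite sweedler_ract; last by lin.
        rewrite sweedler_exchange.
        over.
      rewrite sweedler_exchange.
      over.
    over.
  rewrite sweedler_exchange; apply: eq_sweedler => a1 a2.
  by rewrite sweedler_exchange.
transitivity
  (\sweedler_(a1, a2 <- hcomul DB a) \sweedler_(g1, g2 <- hcomul DH g)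
   \sweedler_(p, q <- DeltaP (h *t b))
   \sweedler_(p1, p2 <- DeltaP p) \sweedler_(q1, q2 <- DeltaP q)
     K a1 a2 g1 g2 (lact p1) (ract p2) (lact q1) (ract q2)); last first.
  rewrite sweedler_dc_comul; last by lin.
  apply: eq_sweedler => a1 a2.
  under [RHS]eq_sweedler => h1 h2.
    rewrite sweedler_dc_comul; last by lin.
    rewrite sweedler_exchange.
    over.
  rewrite [RHS]sweedler_exchange; apply: eq_sweedler => g1 g2.
  rewrite sweedler_dc_comul; last by rewrite /K; lin.
  apply: eq_sweedler => h1 h2; apply: eq_sweedler => b1 b2.
  rewrite !dc_mulEP (sweedler_linear (g := fun x => x *t _)); last by lin.
  apply: eq_sweedler => p1 p2.
  by rewrite (sweedler_linear (g := fun x => _ *t x)); last by lin.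
apply: eq_sweedler => a1 a2; apply: eq_sweedler => g1 g2.
(* With c1, ..., c4 the fourfold coproduct of h (x) b, both sides feed c1 to the first [lact] and c4
   to the last [ract]; they differ by the swap of c2 and c3 between the two middle actions, which is
   the exchange condition. *)
rewrite (sweedler_coassoc4 coalgP (F := fun p1 p2 q1 q2 =>
  K _ _ _ _ (lact p1) (ract q1) (lact p2) (ract q2))); try by rewrite /K; lin.
rewrite (sweedler_coassoc4 coalgP (F := fun p1 p2 q1 q2 =>
  K _ _ _ _ (lact p1) (ract p2) (lact q1) (ract q2))); try by rewrite /K; lin.
do 2!apply: eq_sweedler => ? ?.
rewrite -(sweedler_matched (F := fun x y => K _ _ _ _ _ x y _)) //.
by rewrite /K; lin.
Qed.

Lemma dc_counit_lact p : hcounit DB (lact p) = dc_counit DH DB p.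
Proof.
move: p; apply: eq_tensor => [||h a]; [lin|lin|].
by rewrite (lmc_counit (mp_lact pairBH)) dc_counitE.
Qed.

Lemma dc_counit_ract p : hcounit DH (ract p) = dc_counit DH DB p.
Proof.
move: p; apply: eq_tensor => [||h a]; [lin|lin|].
by rewrite (rmc_counit (mp_ract pairBH)) dc_counitE.
Qed.

Lemma dc_counitM x y :
  dc_counit DB DH (M (x *t y)) = dc_counit DB DH x * dc_counit DB DH y.
Proof.
move: x; apply: eq_tensor => [||a h]; [lin|lin|].
move: y; apply: eq_tensor => [||b g]; [lin|lin|].
rewrite dc_mulEP (sweedler_linear (g := dc_counit DB DH)); last by lin.
transitivity (\sweedler_(p, q <- DeltaP (h *t b)) (dc_counit DH DB p *:
    ((hcounit DB a * dc_counit DH DB q) * hcounit DH g : k^o))).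
  apply: eq_sweedler => p q.
  rewrite dc_counitE (hb_counitM bialgB) (hb_counitM bialgH).
  by rewrite dc_counit_lact dc_counit_ract mulrACA mulrCA.
rewrite (sweedler_counitl coalgP (F := fun q =>
  (hcounit DB a * dc_counit DH DB q) * hcounit DH g : k^o)); last by lin.
by rewrite !dc_counitE mulrA mulrA -!mulrA.
Qed.

(** Since antipodes reverse coproducts, expanding the product on the right yields the indices of the
    antipode formula. The antipode axioms then reduce to those of B and H by associativity. *)
Lemma dc_antipode_factor a h :
  dc_antipode DB DH ract lact (a *t h) =
  M ((hone DB *t hantipode DH h) *t (hantipode DB a *t hone DH)).
Proof.
rewrite dc_antipodeE dc_mulE !antipode_comul //.
rewrite sweedler_sweedler; last by lin.
under [RHS]eq_sweedler => h1 h2.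
  rewrite sweedler_sweedler; last by lin.
  over.
rewrite sweedler_exchange; do 2!apply: eq_sweedler => ? ?.
by rewrite hopf_mul1 // hopf_1mul.
Qed.

Let antiB := hh_antipode hopfB.
Let antiH := hh_antipode hopfH.

Lemma dc_antipode_mull x :
  \sweedler_(x1, x2 <- dc_comul DB DH x)
    M (dc_antipode DB DH ract lact x1 *t x2) =
  dc_counit DB DH x *: (hone DB *t hone DH).
Proof.
move: x; apply: eq_tensor => [||a h]; [lin|lin|].
rewrite sweedler_dc_comul; last by lin.
rewrite sweedler_exchange.
under eq_sweedler => h1 h2.
  under eq_sweedler => a1 a2.
    rewrite dc_antipode_factor -dc_mulA dc_mul_unitl.
    over.
  rewrite -(sweedler_linear (g := fun z => M (_ *t (z *t h2)))); last by lin.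
  rewrite (anti_mull antiB) tensorZl tensorZr linearZ /= dc_mul_unitr.
  over.
rewrite -(sweedler_linear (g := fun z => _ *: (_ *t z))); last by lin.
by rewrite (anti_mull antiH) tensorZr scalerA dc_counitE.
Qed.

Lemma dc_antipode_mulr x :
  \sweedler_(x1, x2 <- dc_comul DB DH x)
    M (x1 *t dc_antipode DB DH ract lact x2) =
  dc_counit DB DH x *: (hone DB *t hone DH).
Proof.
move: x; apply: eq_tensor => [||a h]; [lin|lin|].
rewrite sweedler_dc_comul; last by lin.
under eq_sweedler => a1 a2.
  under eq_sweedler => h1 h2.
    rewrite dc_antipode_factor dc_mulA dc_mul_unitr.
    over.
  rewrite -(sweedler_linear (g := fun z => M ((a1 *t z) *t _))); last by lin.
  rewrite (anti_mulr antiH) tensorZr tensorZl linearZ /= dc_mul_unitl.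
  over.
rewrite -(sweedler_linear (g := fun z => _ *: (z *t _))); last by lin.
by rewrite (anti_mulr antiB) tensorZl scalerA dc_counitE mulrC.
Qed.

Lemma double_cross_product_ordinary :
  is_hom_hopf_algebra (double_cross_product DB DH ract lact).
Proof.
have twist1 : dc_twist DB DH = \1%VF.
  apply/lfunP; apply: eq_tensor => [||a h]; [lin|lin|].
  by rewrite dc_twistE twistB twistH !id_lfunE.
split; split => /=; rewrite ?twist1.
- split=> [|x y z|x|x|x y|]; rewrite ?id_lfunE //.
  + by exists id => x; rewrite id_lfunE.
  + exact: dc_mulA.
  + exact: dc_mul1.
  + exact: dc_1mul.
- exact: dc_coalgebra.
- exact: dc_comulM.
- rewrite dc_comulE (hb_comul1 bialgB) (hb_comul1 bialgH).
  by rewrite !sweedler_pure //; lin.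
- exact: dc_counitM.
- by rewrite dc_counitE (hb_counit1 bialgB) (hb_counit1 bialgH) mulr1.
- by move=> x; rewrite !id_lfunE.
- exact: dc_antipode_mull.
- exact: dc_antipode_mulr.
Qed.

End OrdinaryMatchedPair.

(** * Twisting by an automorphism *)

Section Twisting.

Variables (k : fieldType) (H : vectType k).
Implicit Types (D : homHopfData H) (phi psi : 'End(H)).

(* [phi] stands for the inverse of [psi]; it is passed explicitly so that     *)
(* twisting by an inverse does not involve ((_^-1)^-1).                       *)
Definition twisted psi phi D := HomHopfData
  (psi \o htwist D)%VF (psi \o hmul D)%VF (hone D)
  (hcomul D \o phi)%VF (hcounit D) (hantipode D).

Record hopf_automorphism D psi phi : Prop := HopfAutomorphism {
  haut_can : cancel psi phi;
  haut_canV : cancel phi psi;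
  haut_twist : forall h, psi (htwist D h) = htwist D (psi h);
  haut_mul : forall h g, psi (hmul D (h *t g)) = hmul D (psi h *t psi g);
  haut_one : psi (hone D) = hone D;
  haut_comul : forall h, hcomul D (psi h) =
    \sweedler_(h1, h2 <- hcomul D h) (psi h1 *t psi h2);
  haut_counit : forall h, hcounit D (psi h) = hcounit D h;
  haut_antipode : forall h, hantipode D (psi h) = psi (hantipode D h)
}.

Lemma sweedler_haut_comul D psi phi (W : vectType k) (F : H -> H -> W) h :
  hopf_automorphism D psi phi -> bilinearf F ->
  \sweedler_(x, y <- hcomul D (psi h)) F x y =
  \sweedler_(x, y <- hcomul D h) F (psi x) (psi y).
Proof. by move=> aut bF; rewrite (haut_comul aut) sweedler_sweedler. Qed.

Lemma hopf_automorphismV D psi phi :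
  hopf_automorphism D psi phi -> hopf_automorphism D phi psi.
Proof.
move=> aut; have [psiK phiK psiT psiM psi1 psiD psie psiS] := aut.
split=> // [h|h g||h|h|h].
- by apply: (can_inj psiK); rewrite psiT !phiK.
- by apply: (can_inj psiK); rewrite psiM !phiK.
- by rewrite -{1}psi1 psiK.
- rewrite -{2}(phiK h) (sweedler_haut_comul _ aut); last by lin.
  under eq_sweedler do rewrite !psiK.
  by rewrite -{1}[hcomul D _]sweedler_tensorp.
- by rewrite -psie phiK.
- by apply: (can_inj psiK); rewrite -psiS !phiK.
Qed.

(** Each clause is a compatibility of the twist already among the axioms; hence one may twist by it
    or by its inverse. *)
Lemma htwist_automorphism D : is_hom_hopf_algebra D ->
  hopf_automorphism D (htwist D) ((htwist D)^-1)%VF.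
Proof.
move=> [[algD coalgD _ _ _ _] antiD].
have bij := ha_bij algD.
split=> //.
- exact: lfunK.
- exact: lfunVK.
- exact: ha_twistM algD.
- exact: ha_twist1 algD.
- exact: hc_comul_twist coalgD.
- exact: hc_counit_twist coalgD.
- exact: anti_twist antiD.
Qed.

(** As [psi] and [phi] commute with all structure maps, they can be collected in equal powers on
    both sides of each axiom. The antipode is unchanged because [psi] fixes the unit and [phi]
    preserves the counit. *)
Lemma twisted_hopf D psi phi : hopf_automorphism D psi phi ->
  is_hom_hopf_algebra D -> is_hom_hopf_algebra (twisted psi phi D).
Proof.
move=> aut [bialgD antiD]; have autV := hopf_automorphismV aut.
have [algD coalgD comulM comul1 counitM counit1] := bialgD.
have [psiK phiK psiT psiM psi1 psiD psie psiS] := aut.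
have [_ _ phiT phiM phi1 phiD phie phiS] := autV.
have bij := ha_bij algD.
have bij' : bijective (psi \o htwist D)%VF.
  apply: (eq_bij (f := psi \o htwist D)); last by move=> x; rewrite comp_lfunE.
  by apply: bij_comp => //; exists phi.
have inv' : ((psi \o htwist D)^-1 = (htwist D)^-1 \o phi)%VF.
  apply: inv_lfun_can => x; rewrite !comp_lfunE.
    by rewrite psiK lfunK.
  by rewrite lfunVK ?phiK.
have phiTV x : ((htwist D)^-1)%VF (phi x) = phi (((htwist D)^-1)%VF x).
  by apply: (bij_inj bij); rewrite -phiT !lfunVK.
split=> /=.
  split=> /=.
  - split=> // [a b c|a|a|a b|]; rewrite !comp_lfunE /=.
    + by rewrite -!psiM (ha_assoc algD).
    + by rewrite (ha_mul1 algD).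
    + by rewrite (ha_1mul algD).
    + by rewrite -psiT (ha_twistM algD) !psiM.
    + by rewrite (ha_twist1 algD).
  - split=> // [c|c|c|c|c].
    + rewrite inv' comp_lfunE.
      rewrite !(sweedler_haut_comul _ autV); try lin.
      (* Two nested new coproducts, or one and the new inverse twist, put [phi] twice on every
         factor: new coassociativity is the old one under this [F]. *)
      pose F x y z := phi (phi x) *t (phi (phi y) *t phi (phi z)).
      have tF : trilinearf F by rewrite /F; lin.
      have := sweedler_hom_coassoc c coalgD tF.
      congr (_ = _); apply: eq_sweedler => x y; rewrite !comp_lfunE.
        rewrite !(sweedler_haut_comul _ autV); try lin.
        by apply: eq_sweedler => ? ?; rewrite /F -!phiTV.
      rewrite !(sweedler_haut_comul _ autV); try lin.
      by apply: eq_sweedler => ? ?; rewrite /F -!phiTV.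
    + by rewrite inv' !comp_lfunE (hc_counitr coalgD).
    + by rewrite inv' !comp_lfunE (hc_counitl coalgD).
    + rewrite !comp_lfunE /= psiK (sweedler_haut_comul _ autV); last by lin.
      rewrite (hc_comul_twist coalgD).
      by apply: eq_sweedler => ? ?; rewrite !comp_lfunE /= psiT phiK psiT phiK.
    + by rewrite comp_lfunE /= psie (hc_counit_twist coalgD).
  - move=> h g; rewrite !comp_lfunE /= psiK comulM.
    rewrite (sweedler_haut_comul _ autV); last by lin.
    apply: eq_sweedler => ? ?.
    rewrite (sweedler_haut_comul _ autV); last by lin.
    by apply: eq_sweedler => ? ?; rewrite !comp_lfunE /= !psiM !phiK.
  - by rewrite comp_lfunE /= phi1.
  - by move=> h g; rewrite comp_lfunE /= psie.
  - by [].
split=> /= h; rewrite ?comp_lfunE /=.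
- by rewrite psiS (anti_twist antiD).
- under eq_sweedler do rewrite comp_lfunE.
  rewrite -(sweedler_linear (g := psi)); last by lin.
  by rewrite (anti_mull antiD) linearZ /= psi1 phie.
- under eq_sweedler do rewrite comp_lfunE.
  rewrite -(sweedler_linear (g := psi)); last by lin.
  by rewrite (anti_mulr antiD) linearZ /= psi1 phie.
Qed.

End Twisting.

(** * Reduction to trivial twists *)

Section Untwisting.

Variables (k : fieldType) (B H : vectType k).
Variables (DB : homHopfData B) (DH : homHopfData H).
Variables (ract : 'Hom(tensor H B, H)) (lact : 'Hom(tensor H B, B)).
Hypothesis pairBH : is_matched_pair DB DH ract lact.

Local Notation alpha := (htwist DH).
Local Notation beta := (htwist DB).
Local Notation alphaV := ((htwist DH)^-1)%VF.
Local Notation betaV := ((htwist DB)^-1)%VF.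

Definition untwisted (U : vectType k) (D : homHopfData U) :=
  twisted ((htwist D)^-1)%VF (htwist D) D.

Let hopfB := mp_hopfB pairBH.
Let hopfH := mp_hopfH pairBH.
Let autB := htwist_automorphism hopfB.
Let autH := htwist_automorphism hopfH.
Let autVB := hopf_automorphismV autB.
Let autVH := hopf_automorphismV autH.
Let alphaK : cancel alpha alphaV := haut_can autH.
Let alphaVK : cancel alphaV alpha := haut_canV autH.
Let betaK : cancel beta betaV := haut_can autB.
Let betaVK : cancel betaV beta := haut_canV autB.

Lemma untwisted_hopf (U : vectType k) (D : homHopfData U) :
  is_hom_hopf_algebra D -> is_hom_hopf_algebra (untwisted D).
Proof.
move=> hD.
exact: twisted_hopf (hopf_automorphismV (htwist_automorphism hD)) hD.
Qed.

Lemma untwisted_htwist (U : vectType k) (D : homHopfData U) :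
  is_hom_hopf_algebra D -> htwist (untwisted D) = \1%VF.
Proof.
move=> hD; apply/lfunP => u; rewrite comp_lfunE id_lfunE.
exact: haut_can (htwist_automorphism hD) u.
Qed.

Let ract_twist h a : alpha (ract (h *t a)) = ract (alpha h *t beta a).
Proof. exact: rm_twist (rmc_mod (mp_ract pairBH)) h a. Qed.

Let lact_twist h a : beta (lact (h *t a)) = lact (alpha h *t beta a).
Proof. exact: lm_twist (lmc_mod (mp_lact pairBH)) h a. Qed.

Let ractV h a : alphaV (ract (alpha h *t beta a)) = ract (h *t a).
Proof. by rewrite -ract_twist alphaK. Qed.

Let lactV h a : betaV (lact (alpha h *t beta a)) = lact (h *t a).
Proof. by rewrite -lact_twist betaK. Qed.

Let ractVl h a : ract (alphaV h *t a) = alphaV (ract (h *t beta a)).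
Proof. by rewrite -{2}(alphaVK h) ractV. Qed.

Let lactVl h a : lact (alphaV h *t a) = betaV (lact (h *t beta a)).
Proof. by rewrite -{2}(alphaVK h) lactV. Qed.

Let lactVr h a : lact (h *t betaV a) = betaV (lact (alpha h *t a)).
Proof. by rewrite -{2}(betaVK a) lactV. Qed.

Let ractVr h a : ract (h *t betaV a) = alphaV (ract (alpha h *t a)).
Proof. by rewrite -{2}(betaVK a) ractV. Qed.

(** Like the products, each action is followed by the inverse twist of its target; the actions
    commute with the twists, so all twists cancel in the axioms. *)
Lemma untwisted_pair :
  is_matched_pair (untwisted DB) (untwisted DH)
    (alphaV \o ract)%VF (betaV \o lact)%VF.
Proof.
have hopfB0 := untwisted_hopf hopfB; have hopfH0 := untwisted_hopf hopfH.
have twistB0 := untwisted_htwist hopfB; have twistH0 := untwisted_htwist hopfH.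
have sweedlerB := sweedler_haut_comul _ autB.
have sweedlerH := sweedler_haut_comul _ autH.
split=> //; rewrite ?twistB0 ?twistH0.
- rewrite -twistH0; split.
  + exact: hb_coalg (hh_bialg hopfH0).
  + have := rmc_mod (mp_ract pairBH) => -[_ ractA ract1 _].
    rewrite twistH0; split=> [|h a b|h|h a]; rewrite ?twistB0.
    * by exists id => x; rewrite id_lfunE.
    * rewrite /= !comp_lfunE /= !id_lfunE.
      by rewrite ractVl ractVr ractA.
    * by rewrite /= comp_lfunE /= ract1 alphaK id_lfunE.
    * by rewrite !id_lfunE.
  + move=> h a; rewrite /= !comp_lfunE /= alphaVK (rmc_comul (mp_ract pairBH)).
    rewrite sweedlerH; last by lin.
    apply: eq_sweedler => ? ?; rewrite sweedlerB; last by lin.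
    by apply: eq_sweedler => ? ?; rewrite !comp_lfunE /= !ractV.
  + move=> h a; rewrite /= comp_lfunE /= (haut_counit autVH).
    exact: rmc_counit (mp_ract pairBH) h a.
- rewrite -twistB0; split.
  + exact: hb_coalg (hh_bialg hopfB0).
  + have := lmc_mod (mp_lact pairBH) => -[_ lactA lact1 _].
    rewrite twistB0; split=> [|h g a|a|h a]; rewrite ?twistH0.
    * by exists id => x; rewrite id_lfunE.
    * rewrite /= !comp_lfunE /= !id_lfunE.
      by rewrite lactVl lactVr lactA.
    * by rewrite /= comp_lfunE /= lact1 betaK id_lfunE.
    * by rewrite !id_lfunE.
  + move=> h a; rewrite /= !comp_lfunE /= betaVK (lmc_comul (mp_lact pairBH)).
    rewrite sweedlerH; last by lin.
    apply: eq_sweedler => ? ?; rewrite sweedlerB; last by lin.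
    by apply: eq_sweedler => ? ?; rewrite !comp_lfunE /= !lactV.
  + move=> h a; rewrite /= comp_lfunE /= (haut_counit autVB).
    exact: lmc_counit (mp_lact pairBH) h a.
(* Pulling the twists out of the coproducts of [alpha g] and [beta a] cancels the [betaV a1] of the
   Hom-condition and produces its [alpha g2]. *)
- move=> h g a; rewrite /= !comp_lfunE /= ractVl (mp_mul_ract pairBH).
  do 2![rewrite (sweedler_linear (g := alphaV)); last by lin].
  rewrite sweedlerH; last by lin.
  apply: eq_sweedler => g1 g2.
  do 2![rewrite (sweedler_linear (g := alphaV)); last by lin].
  rewrite !sweedlerB; try lin.
  apply: eq_sweedler => a1 a2.
  rewrite betaK !comp_lfunE /= inv_id_lfun id_lfunE lactV.
  by rewrite -(haut_mul autVH).
- move=> a; rewrite /= comp_lfunE /= (mp_one_ract pairBH) linearZ /=.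
  by rewrite (haut_one autVH).
- move=> h a b; rewrite /= !comp_lfunE /= lactVr (mp_lact_mul pairBH).
  do 2![rewrite (sweedler_linear (g := betaV)); last by lin].
  rewrite !sweedlerH; try lin.
  apply: eq_sweedler => h1 h2.
  do 2![rewrite (sweedler_linear (g := betaV)); last by lin].
  rewrite sweedlerB; last by lin.
  apply: eq_sweedler => a1 a2.
  rewrite alphaK !comp_lfunE /= inv_id_lfun id_lfunE ractV.
  by rewrite -(haut_mul autVB).
- move=> h; rewrite /= comp_lfunE /= (mp_lact_one pairBH) linearZ /=.
  by rewrite (haut_one autVB).
move=> h a; rewrite /= !comp_lfunE /=; have := mp_exchange pairBH h a.
rewrite !sweedlerH; try lin.
congr (_ = _); apply: eq_sweedler => ? ?; rewrite sweedlerB; try lin.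
  by apply: eq_sweedler => ? ?; rewrite !comp_lfunE /= ractV lactV.
by apply: eq_sweedler => ? ?; rewrite !comp_lfunE /= ractV lactV.
Qed.

Local Notation D0 := (double_cross_product (untwisted DB) (untwisted DH)
  (alphaV \o ract)%VF (betaV \o lact)%VF).

(** Explicit inverse of [dc_twist DB DH], to serve as the argument [phi] of [twisted]. *)
Definition dc_untwist : 'End(tensor B H) :=
  tlift (fun a h => betaV a *t alphaV h).

Lemma dc_untwistE a h : dc_untwist (a *t h) = betaV a *t alphaV h.
Proof. by rewrite /dc_untwist sweedler_pure //; lin. Qed.

(** The twists commute with the structure maps of B and H and with both actions, from which every
    structure map of [D0] is built. *)
Lemma dc_twist_automorphism :
  hopf_automorphism D0 (dc_twist DB DH) dc_untwist.
Proof.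
have sweedlerB := sweedler_haut_comul _ autB.
have sweedlerH := sweedler_haut_comul _ autH.
split=> /=.
- apply: eq_tensor => [||a h]; [lin|lin|].
  by rewrite dc_twistE dc_untwistE betaK alphaK.
- apply: eq_tensor => [||a h]; [lin|lin|].
  by rewrite dc_untwistE dc_twistE betaVK alphaVK.
- apply: eq_tensor => [||a h]; [lin|lin|].
  by rewrite !(dc_twistE, untwisted_htwist) // !id_lfunE.
- move=> x y.
  move: x; apply: eq_tensor => [||a h]; [lin|lin|].
  move: y; apply: eq_tensor => [||b g]; [lin|lin|].
  rewrite !dc_twistE !dc_mulE !comp_lfunE.
  rewrite (sweedler_linear (g := dc_twist DB DH)); last by lin.
  rewrite [RHS]sweedlerH; last by lin.
  apply: eq_sweedler => h1 h2.
  rewrite (sweedler_linear (g := dc_twist DB DH)); last by lin.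
  rewrite [RHS]sweedlerB; last by lin.
  apply: eq_sweedler => b1 b2.
  rewrite dc_twistE !comp_lfunE /= betaVK alphaVK lactV ractV.
  by rewrite (haut_mul autVB) (haut_mul autVH) betaK alphaK.
- by rewrite dc_twistE (haut_one autB) (haut_one autH).
- apply: eq_tensor => [||a h]; [lin|lin|].
  rewrite dc_twistE !dc_comulE !comp_lfunE /=.
  rewrite sweedlerB; last by lin.
  rewrite [RHS](sweedler_linear (g := tlift _)); last exact: linear_lfun.
  apply: eq_sweedler => a1 a2.
  rewrite sweedler_sweedler; last by lin.
  rewrite sweedlerH; last by lin.
  by apply: eq_sweedler => h1 h2; rewrite !dc_twistE.
- apply: eq_tensor => [||a h]; [lin|lin|].
  by rewrite dc_twistE !dc_counitE (haut_counit autB) (haut_counit autH).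
apply: eq_tensor => [||a h]; [lin|lin|].
rewrite dc_twistE !dc_antipodeE !comp_lfunE /=.
rewrite (sweedler_linear (g := dc_twist DB DH)); last by lin.
rewrite sweedlerB; last by lin.
apply: eq_sweedler => a1 a2.
rewrite (sweedler_linear (g := dc_twist DB DH)); last by lin.
rewrite sweedlerH; last by lin.
apply: eq_sweedler => h1 h2.
rewrite dc_twistE !comp_lfunE /= betaVK alphaVK.
by rewrite !(haut_antipode autB) !(haut_antipode autH) lactV ractV.
Qed.

Lemma double_cross_product_twisted :
  double_cross_product DB DH ract lact =
  twisted (dc_twist DB DH) dc_untwist D0.
Proof.
have sweedlerB := sweedler_haut_comul _ autB.
have sweedlerH := sweedler_haut_comul _ autH.
(* Unit and counit agree by conversion, as twisting changes neither; four maps remain to be compared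
   on pure tensors. *)
congr HomHopfData.
- apply/lfunP; apply: eq_tensor => [||a h]; [lin|lin|].
  by rewrite comp_lfunE !dc_twistE !untwisted_htwist // !id_lfunE.
- apply/lfunP; apply: eq_tensor => [||x y]; [lin|lin|].
  move: x; apply: eq_tensor => [||a h]; [lin|lin|].
  move: y; apply: eq_tensor => [||b g]; [lin|lin|].
  rewrite comp_lfunE !dc_mulE !comp_lfunE.
  rewrite (sweedler_linear (g := dc_twist DB DH)); last by lin.
  rewrite [RHS]sweedlerH; last by lin.
  apply: eq_sweedler => h1 h2.
  rewrite (sweedler_linear (g := dc_twist DB DH)); last by lin.
  rewrite [RHS]sweedlerB; last by lin.
  apply: eq_sweedler => b1 b2.
  by rewrite dc_twistE !comp_lfunE /= betaVK alphaVK lactV ractV.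
- apply/lfunP; apply: eq_tensor => [||a h]; [lin|lin|].
  by rewrite comp_lfunE dc_untwistE !dc_comulE !comp_lfunE /= betaVK alphaVK.
- apply/lfunP; apply: eq_tensor => [||a h]; [lin|lin|].
  rewrite !dc_antipodeE !comp_lfunE /=.
  rewrite [RHS]sweedlerB; last by lin.
  apply: eq_sweedler => a1 a2.
  rewrite sweedlerH; last by lin.
  apply: eq_sweedler => h1 h2.
  rewrite !comp_lfunE /= !(haut_antipode autB, haut_antipode autH).
  by rewrite ractV lactV.
Qed.

End Untwisting.

Theorem theorem4p2 (k : fieldType) (B H : vectType k)
    (DB : homHopfData B) (DH : homHopfData H)
    (ract : 'Hom(tensor H B, H)) (lact : 'Hom(tensor H B, B)) :
  is_matched_pair DB DH ract lact ->
  is_hom_hopf_algebra (double_cross_product DB DH ract lact).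
Proof.
move=> pairBH; rewrite double_cross_product_twisted //.
apply: twisted_hopf (dc_twist_automorphism pairBH) _.
apply: double_cross_product_ordinary (untwisted_pair pairBH) _ _.
  exact: untwisted_htwist (mp_hopfB pairBH).
exact: untwisted_htwist (mp_hopfH pairBH).
Qed.
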